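(* $f(7) \le 22$.
   Context: A hypergraph $\mathcal{H}$ consists of a vertex set $V(\mathcal{H})$ and a set $E(\mathcal{H})$ of edges, each a nonempty subset of $V(\mathcal{H})$. It is $r$-partite if $V(\mathcal{H})$ can be partitioned into $r$ parts such that every edge contains exactly one vertex from each part. It is intersecting if every two edges share at least one vertex. A cover of $\mathcal{H}$ is a set of vertices meeting every edge, and $\tau(\mathcal{H})$ is the minimum size of a cover. For $r \ge 2$, $f(r)$ denotes the minimum integer such that there exists an $r$-partite intersecting hypergraph $\mathcal{H}$ with $\tau(\mathcal{H}) = r-1$ and with exactly $f(r)$ edges. *)

(* Defs.v *)
From mathcomp Require Import all_boot.

Set Implicit Arguments.
Unset Strict Implicit.
Unset Printing Implicit Defensive.

Record hypergraph := Hypergraph {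
  vertex : finType;
  edges : {set {set vertex}};
  edges_nonempty : set0 \notin edges
}.

(* [partition] requires nonempty parts.  This is no restriction as soon as
   there is an edge, since every part must then meet it. *)
Definition partite (r : nat) (H : hypergraph) : Prop :=
  exists P : {set {set vertex H}},
    [/\ partition P [set: vertex H], #|P| = r &
        forall e B, e \in edges H -> B \in P -> #|e :&: B| = 1].

Definition intersecting (H : hypergraph) : Prop :=
  forall e1 e2, e1 \in edges H -> e2 \in edges H -> e1 :&: e2 != set0.

Definition is_cover (H : hypergraph) (C : {set vertex H}) : bool :=
  [forall e in edges H, C :&: e != set0].

(* The base point [set: vertex H] is a cover because edges are nonempty. *)
Definition tau (H : hypergraph) : nat :=
  #|[arg min_(C < [set: vertex H] | is_cover C) #|C|]|.

Definition extremal (r m : nat) : Prop :=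
  exists H : hypergraph,
    [/\ partite r H, intersecting H, tau H = r - 1 & #|edges H| = m].

(* "f(r) = m".  The minimum is a relation rather than a function, because a
   total function would need a junk value for those r for which no extremal
   hypergraph exists; "f(r) <= k" then includes the existence of f(r). *)
Definition is_f (r m : nat) : Prop :=
  extremal r m /\ forall k : nat, extremal r k -> m <= k.

(* Main.v *)
Require Import Defs.
From mathcomp Require Import all_boot.
From Stdlib Require Import Classical_Prop.

(** A hypergraph with 7 sides of 6 vertices is given by words of length 7 over
    the alphabet {0, ..., 5}: two edges meet when the words agree at some
    position.  The 21 cyclic shifts of the words 0000112, 0113451 and 0350544
    agree pairwise, and no five vertices cover them: a cover contains a vertex
    of each edge not yet covered, so a search tree of depth 5 and branching 7
    decides this.  Hence f(7) <= 21.  The three words were found by a computer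
    search among the families invariant under cyclic shifts. *)

(** The graph of the word: the position is the side, the letter is the vertex on it. A letter
    outside ['I_q] gives no vertex. *)
Definition word_edge (n q : nat) (w : seq nat) : {set 'I_n * 'I_q} :=
  [set v : 'I_n * 'I_q | nth 0 w v.1 == v.2].

Definition side (n q : nat) (i : 'I_n) : {set 'I_n * 'I_q} :=
  [set v | v.1 == i].

Definition agree (n : nat) (w u : seq nat) : bool :=
  has (fun i => nth 0 w i == nth 0 u i) (iota 0 n).

Fixpoint coverable (n k : nat) (ws : seq (seq nat)) : bool :=
  if ws is w :: _ then
    if k is k'.+1 then
      has (fun i => coverable n k' [seq u <- ws | nth 0 u i != nth 0 w i])
          (iota 0 n)
    else false
  else true.

(** Some [v] in [C] lies on the edge of the first word. The words whose edges avoid [v] are still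
    met by [C] without [v], and they are what the search keeps when it branches at the side of
    [v]. *)
Lemma coverable_cover (n q k : nat) (ws : seq (seq nat))
    (C : {set 'I_n * 'I_q}) :
  {in ws, forall w, C :&: word_edge n q w != set0} -> #|C| <= k ->
  coverable n k ws.
Proof.
elim: k ws C => [|k IHk] [|w ws] C //= meetC leC.
  have C0 : C = set0 by apply/eqP; rewrite -cards_eq0 -leqn0.
  by have := meetC w (mem_head _ _); rewrite C0 set0I eqxx.
have /set0Pn[v] := meetC w (mem_head _ _).
rewrite !inE => /andP[Cv /eqP wv].
apply/hasP; exists (val v.1); first by rewrite mem_iota add0n ltn_ord.
rewrite eqxx /=; apply: (IHk _ (C :\ v)); last first.
  by have := leC; rewrite (cardsD1 v C) Cv.
move=> u; rewrite mem_filter => /andP[neq us].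
have /set0Pn[x] := meetC u (mem_behead (s := w :: ws) us).
rewrite !inE => /andP[Cx /eqP ux]; apply/set0Pn; exists x.
rewrite !inE Cx ux eqxx !andbT.
by apply: contra neq => /eqP eq_xv; rewrite -eq_xv ux eq_xv wv.
Qed.

Lemma card_word_edge_side (n q : nat) (w : seq nat) (i : 'I_n) :
  nth 0 w i < q -> #|word_edge n q w :&: side n q i| = 1.
Proof.
move=> ltq; apply/eqP/cards1P; exists (i, Ordinal ltq).
apply/setP=> -[j x]; rewrite !inE xpair_eqE andbC; case: eqP => //= ->.
by rewrite eq_sym.
Qed.

Lemma card_side (n q : nat) (i : 'I_n) : #|side n q i| = q.
Proof.
have -> : side n q i = setX [set i] [set: 'I_q].
  by apply/setP=> v; rewrite !inE andbT.
by rewrite cardsX cards1 cardsT card_ord mul1n.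
Qed.

Lemma side_partition (n q : nat) :
  0 < q -> partition (side n q @: 'I_n) [set: 'I_n * 'I_q]
           /\ #|side n q @: 'I_n| = n.
Proof.
move=> q_gt0.
have set0_notin : set0 \notin side n q @: 'I_n.
  apply/imsetP=> -[i _ /esym/eqP].
  by rewrite -cards_eq0 card_side -leqn0 leqNgt q_gt0.
have disj :
  {in 'I_n &, forall i j, j != i -> [disjoint side n q i & side n q j]}.
  move=> i j _ _ neq; rewrite -setI_eq0; apply/eqP/setP=> v.
  by rewrite !inE; case: eqP => // ->; rewrite eq_sym (negbTE neq).
(* Disjoint nonempty sides are distinct, so there are exactly [n] of them. *)
have [triv inj] := trivIimset disj set0_notin.
split; last by rewrite card_in_imset // card_ord.
rewrite /partition triv set0_notin !andbT eqEsubset subsetT /=.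
apply/subsetP=> v _; apply/bigcupP; exists (side n q v.1); last by rewrite inE.
exact: imset_f.
Qed.

(** With [q.+1] sides of [q] vertices, the required cover number [q] is the size of one side. The
    count [m] is only bounded, since different words may give the same edge. *)
Lemma extremal_of_words (q : nat) (ws : seq (seq nat)) :
  0 < q -> all (fun w => all (fun i => nth 0 w i < q) (iota 0 q.+1)) ws ->
  all (fun w => all (agree q.+1 w) ws) ws -> ~~ coverable q.+1 q.-1 ws ->
  exists2 m, extremal q.+1 m & m <= size ws.
Proof.
move=> q_gt0 /allP ws_lt /allP ws_agree not_cov.
have lt_q w (i : 'I_q.+1) : w \in ws -> nth 0 w i < q.
  by move=> /ws_lt /allP; apply; rewrite mem_iota add0n ltn_ord.
set E := [set:: [seq word_edge q.+1 q w | w <- ws]].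
have edgeP e : e \in E -> exists2 w, w \in ws & e = word_edge q.+1 q w.
  by rewrite inE => /mapP.
have side_meet w i : w \in ws -> word_edge q.+1 q w :&: side q.+1 q i != set0.
  by move=> wws; rewrite -cards_eq0 card_word_edge_side ?lt_q.
have E0 : set0 \notin E.
  apply/negP=> /edgeP[w wws we]; have := side_meet w ord0 wws.
  by rewrite -we set0I eqxx.
pose H := Hypergraph E0.
exists #|E|; last by rewrite cardsE (leq_trans (card_size _)) // size_map.
exists H; split=> //.
- have [part cardP] := side_partition q.+1 q q_gt0.
  exists (side q.+1 q @: 'I_q.+1); split=> // e B.
  move=> /edgeP[w wws ->] /imsetP[i _ ->].
  exact/card_word_edge_side/lt_q.
- move=> e1 e2 /edgeP[w wws ->] /edgeP[u uws ->].
  have /allP/(_ u uws)/hasP[i] := ws_agree w wws.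
  rewrite mem_iota add0n => /= lti /eqP agr.
  apply/set0Pn; exists (Ordinal lti, Ordinal (lt_q w (Ordinal lti) wws)).
  by rewrite !inE /= agr eqxx.
- rewrite /tau subn1 /=.
  case: arg_minnP => [|C coverC minC].
    apply/forall_inP=> e eE; rewrite setTI.
    by apply/eqP=> e0; have := E0; rewrite -e0 eE.
  apply/eqP; rewrite eqn_leq; apply/andP; split.
    (* A single side is a cover, so the minimum is at most [q]. *)
    apply: leq_trans (eq_leq (card_side q.+1 q ord0)); apply: minC.
    by apply/forall_inP=> e /edgeP[w wws ->]; rewrite setIC side_meet.
  (* A cover of fewer than [q] vertices would make the search of depth [q.-1] succeed. *)
  rewrite leqNgt; apply: contra not_cov => ltC.
  apply: (@coverable_cover _ q _ _ C); last by rewrite -ltnS prednK.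
  move=> w wws; apply: (forall_inP coverC).
  by rewrite inE map_f.
Qed.

Definition words21 : seq (seq nat) :=
  [seq rot k w | w <- [:: [:: 0; 0; 0; 0; 1; 1; 2];
                          [:: 0; 1; 1; 3; 4; 5; 1];
                          [:: 0; 3; 5; 0; 5; 4; 4]], k <- iota 0 7].

Lemma words21_not_coverable : ~~ coverable 7 5 words21.
Proof. by vm_compute. Qed.

(** [P] is an arbitrary proposition, such as [extremal 7], so excluded middle decides whether a
    smaller witness exists. *)
Lemma exists_minimum (P : nat -> Prop) (n : nat) :
  P n -> exists m, (P m /\ forall k, P k -> m <= k) /\ m <= n.
Proof.
elim/ltn_ind: n => n IHn Pn.
have [[k [ltkn Pk]]|no_smaller] := classic (exists k, k < n /\ P k).
  have [m [minm lemk]] := IHn k ltkn Pk.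
  by exists m; split=> //; apply: leq_trans lemk (ltnW ltkn).
exists n; do 2!split=> //; move=> k Pk; rewrite leqNgt; apply/negP=> ltkn.
by apply: no_smaller; exists k.
Qed.

Theorem theorem3 : exists m : nat, is_f 7 m /\ m <= 22.
Proof.
have [//||||n extn len] := @extremal_of_words 6 words21.
- by vm_compute.
- by vm_compute.
- exact: words21_not_coverable.
have [m [minm lemn]] := @exists_minimum (extremal 7) n extn.
(* The chain is [m <= n <= size words21 = 21 <= 22]. *)
by exists m; split=> //; apply: leq_trans lemn (leq_trans len _).
Qed.
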